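(* Let $k\ge 2$, $s\ge 2$, $n\ge 1$ be integers. Let $H$ be the graph with vertex set $\{u_i,v_i:1\le i\le 2k\}\cup\{x_{i,j}:1\le i\le k,\ 1\le j\le 2n+1\}$ and edges $u_iv_i$ ($1\le i\le 2k$) and $u_ix_{i,j}, v_ix_{i,j}, u_{2k+1-i}x_{i,j}, v_{2k+1-i}x_{i,j}$ ($1\le i\le k$, $1\le j\le 2n+1$), so $H\cong k(2P_2\vee O_{2n+1})$. Suppose $\{u_1,\dots,u_{2k}\}$ is partitioned into blocks each of size $s$ such that no two vertices in the same block have a common neighbor in $H$, and let $G$ be obtained from $H$ by identifying all vertices of each block into a single vertex. Then $\chi_{la}(G)=3$.
   Context: For a graph $G$ with $q$ edges, a local antimagic labeling is a bijection $f:E(G)\to\{1,\dots,q\}$ such that, writing $f^+(u)=\sum_{e\ni u}f(e)$, we have $f^+(u)\ne f^+(v)$ for every edge $uv$. $\chi_{la}(G)$ is the minimum over all local antimagic labelings of the number of distinct values of $f^+$. $aP_2$ is a disjoint union of $a$ one-edge paths, $O_m$ the edgeless graph on $m$ vertices, $\vee$ the join, $kH$ the disjoint union of $k$ copies. The family of such $G$ is denoted $\mathcal J_1(k,2n+1,s)$ in the paper. *)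

(* Defs.v *)
From mathcomp Require Import all_boot.

Set Implicit Arguments.
Unset Strict Implicit.
Unset Printing Implicit Defensive.

Record sgraph := SGraph {
  svertex :> finType;
  sedge : rel svertex;
  sedge_sym : symmetric sedge;
  sedge_irrefl : irreflexive sedge }.

Section LocalAntimagic.

Variable G : sgraph.
Implicit Types (f : {set G} -> nat) (u v : G) (e : {set G}).

Definition edges : {set {set G}} :=
  [set [set p.1; p.2] | p : G * G & sedge p.1 p.2].

(* A labeling is represented by a function on all vertex sets; only its values
   on [edges] are ever used. *)
Definition vsum f u : nat := \sum_(e in edges | u \in e) f e.

Definition edge_labeling f : Prop :=
  {in edges &, injective f} /\
  (forall m : nat, (0 < m <= #|edges|) <-> (exists2 e, e \in edges & f e = m)).

Definition local_antimagic f : Prop :=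
  edge_labeling f /\ forall u v, sedge u v -> vsum f u <> vsum f v.

Definition num_colors f : nat := size (undup [seq vsum f u | u : G]).

(* chi_la(G) = c.  This is a relation rather than a function because some graphs
   (those with a K_2 component) have no local antimagic labeling at all. *)
Definition is_chi_la (c : nat) : Prop :=
  (exists2 f, local_antimagic f & num_colors f = c) /\
  (forall f, local_antimagic f -> c <= num_colors f).

End LocalAntimagic.

Definition common_neighbor (G : sgraph) (a b : G) : Prop :=
  exists w : G, sedge a w /\ sedge b w.

Section Identify.

Variables (G : sgraph) (P : {set {set G}}).

(* Vertices outside every block stay as singleton classes. *)
Definition classes : {set {set G}} := P :|: [set [set x] | x in ~: cover P].

(* The condition [B != C] only discards loops, and no edge of G becomes a loop
   when the blocks are independent sets.  Parallel edges would be merged, but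
   none arise when two vertices of a block never have a common neighbor. *)
Definition identify_rel : rel {B : {set G} | B \in classes} :=
  fun B C => (B != C) && [exists x in val B, exists y in val C, sedge x y].

Lemma identify_sym : symmetric identify_rel.
Proof.
move=> B C; rewrite /identify_rel /= eq_sym; congr andb.
by apply/exists_inP/exists_inP => -[x xB /exists_inP[y yC xy]];
  exists y => //; apply/exists_inP; exists x => //; rewrite sedge_sym.
Qed.

Lemma identify_irrefl : irreflexive identify_rel.
Proof. by move=> B; rewrite /identify_rel /= eqxx. Qed.

Definition identify : sgraph := SGraph identify_sym identify_irrefl.

End Identify.

Section GraphH.

Variables k n : nat.

(* Indices are shifted to start at 0, so that i |-> 2k+1-i becomes [rev_ord]. *)
Definition Hvertex : finType :=
  ('I_(2 * k) + 'I_(2 * k) + 'I_k * 'I_(2 * n + 1))%type.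

Definition Hu (i : 'I_(2 * k)) : Hvertex := inl (inl i).
Definition Hv (i : 'I_(2 * k)) : Hvertex := inl (inr i).
Definition Hx (i : 'I_k) (j : 'I_(2 * n + 1)) : Hvertex := inr (i, j).

Definition Harc : rel Hvertex := fun a b =>
  match a, b with
  | inl (inl i), inl (inr i') => i == i'
  | inl (inl i), inr (i', _) | inl (inr i), inr (i', _) =>
      (i == i' :> nat) || (rev_ord i == i' :> nat)
  | _, _ => false
  end.

Definition Hrel : rel Hvertex := fun a b => Harc a b || Harc b a.

Lemma Hrel_sym : symmetric Hrel.
Proof. by move=> a b; rewrite /Hrel /= orbC. Qed.

Lemma Hrel_irrefl : irreflexive Hrel.
Proof. by move=> [[i|i]|[i j]]. Qed.

Definition graphH : sgraph := SGraph Hrel_sym Hrel_irrefl.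

Definition Hus : {set graphH} := [set Hu i | i : 'I_(2 * k)].

End GraphH.

(* Main.v *)
Require Import Defs.
From mathcomp Require Import all_boot.
From mathcomp Require Import zify.

(* A block, a [v_i] and an [x_ij] span a triangle, so three colors are needed.
   Conversely, identification preserves edges and adds up the vertex sums over
   each block, so it suffices to label H with vertex sums constant on the u's,
   on the v's and on the x's.  Put N = 2k, m = 2n+1 and write the labels
   1, ..., N(2m+1) in rows of N, read forwards or backwards.  Column i of row 0
   labels [u_i v_i]; the m lower rows label the edges [v_i x_ij] and the m upper
   rows the edges [u_i x_ij].  As m + 1 is even, half of the m + 1 rows used at
   the u's (and at the v's) can be read backwards, which makes their column sums
   constant.  Columns i and 2k+1-i of one row have a sum independent of i, so
   the sum at [x_ij] is constant once its two rows have a fixed total index. *)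

Set Implicit Arguments.
Unset Strict Implicit.
Unset Printing Implicit Defensive.

(** * Triangles, and labelings indexed by an arbitrary finite type *)

Lemma set2_inj (T : finType) (a b c d : T) :
  [set a; b] = [set c; d] -> (a = c /\ b = d) \/ (a = d /\ b = c).
Proof.
move=> eq_sets.
have: a \in [set c; d] by rewrite -eq_sets set21.
have: b \in [set c; d] by rewrite -eq_sets set22.
have: c \in [set a; b] by rewrite eq_sets set21.
have: d \in [set a; b] by rewrite eq_sets set22.
rewrite !inE.
by do 4 case/orP=> /eqP ?; (left; split; congruence) || (right; split; congruence).
Qed.

Lemma sum_mem_eq (T : finType) (A : {set T}) (a : T) :
  \sum_(x in A) (x == a) = (a \in A).
Proof.
case: (boolP (a \in A)) => aA.
  by rewrite (bigD1 a) //= eqxx big1 // => x /andP[_ /negPf ->].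
by rewrite big1 // => x xA; case: eqVneq xA => // ->; rewrite (negPf aA).
Qed.

Lemma three_colors (G : sgraph) (f : {set G} -> nat) (a b c : G) :
  local_antimagic f -> sedge a b -> sedge b c -> sedge a c -> 3 <= num_colors f.
Proof.
case=> _ antif ab bc ac; rewrite -[3]/(size [:: vsum f a; vsum f b; vsum f c]).
apply: uniq_leq_size => [|y].
  rewrite /= !inE !andbT negb_or; apply/andP; split; last exact/eqP/antif.
  by apply/andP; split; apply/eqP/antif.
by rewrite mem_undup !inE => /or3P[] /eqP->; apply/map_f; rewrite mem_enum.
Qed.

(** Edges may be labeled through any index type [T] in bijection with them. Only injectivity and
    bounds are asked of [lab]: by counting, it then takes every value from 1 to [#|T|]. *)
Lemma edge_labeling_transport (G : sgraph) (T : finType) (eps : T -> {set G})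
    (lab : T -> nat) :
  injective eps -> [set eps t | t : T] = edges G ->
  injective lab -> (forall t, 0 < lab t <= #|T|) ->
  exists2 f : {set G} -> nat, edge_labeling f &
    forall x, vsum f x = \sum_(t | x \in eps t) lab t.
Proof.
move=> eps_inj eps_img lab_inj lab_bd.
(* Since [eps] is injective, the sum has one term on an edge; it is empty, hence 0, elsewhere. *)
pose f (e : {set G}) := \sum_(t | eps t == e) lab t.
have fE t : f (eps t) = lab t.
  by rewrite /f (big_pred1 t) // => t'; rewrite /= (inj_eq eps_inj).
exists f => [|x].
  split=> [? ?|q].
    rewrite -eps_img => /imsetP[t _ ->] /imsetP[t' _ ->].
    by rewrite !fE => /lab_inj ->.
  have -> : #|edges G| = #|T| by rewrite -eps_img card_imset.
  split=> [q_bd|]; last first.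
    by rewrite -eps_img => -[? /imsetP[t _ ->] <-]; rewrite fE.
  have lab_lt t : (lab t).-1 < #|T| by have := lab_bd t; lia.
  (* Labels shifted down by one give an injection of [T] into an ordinal type of the same size,
     hence a surjection. *)
  pose h t := Ordinal (lab_lt t).
  have h_inj : injective h.
    move=> t t' /(congr1 val) /= eq_h; apply: lab_inj.
    by have := lab_bd t; have := lab_bd t'; lia.
  have q_lt : q.-1 < #|T| by lia.
  have /codomP[t /(congr1 val) /= qt] : Ordinal q_lt \in codom h.
    by apply: inj_card_onto => //; rewrite card_ord.
  exists (eps t); first by rewrite -eps_img imset_f.
  by rewrite fE; have := lab_bd t; lia.
rewrite /vsum -eps_img big_mkcondr big_imset /=; last by move=> ? ? _ _ /eps_inj.
by rewrite [RHS]big_mkcond; apply: eq_bigr => t _; rewrite fE.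
Qed.

(** * Identifying the blocks of a partition of a stable set *)

Section Quotient.

Variables (G : sgraph) (D : {set G}) (P : {set {set G}}).
Hypothesis partP : partition P D.

Definition class_of (x : G) : {set G} :=
  if x \in cover P then pblock P x else [set x].

Lemma class_of_in x : class_of x \in classes P.
Proof.
rewrite /class_of /classes; case: ifPn => xP; rewrite inE.
  by rewrite pblock_mem.
by apply/orP; right; apply: imset_f; rewrite inE.
Qed.

Definition quo (x : G) : identify P := Sub (class_of x) (class_of_in x).

(** The classes are pairwise disjoint, so the class of [x] is the only one containing [x]. Equality
    in the quotient thus becomes membership. *)
Lemma quo_eq x (B : identify P) : (quo x == B) = (x \in val B).
Proof.
case: B => B BP; rewrite -val_eqE /=.
have [_ triv _] := and3P partP.
apply/eqP/idP => [<-|xB].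
  by rewrite /class_of; case: ifPn => xP; rewrite ?mem_pblock ?inE.
move: BP; rewrite inE /class_of => /orP[BP|/imsetP[y]].
  by rewrite (def_pblock triv BP xB) ifT //; apply/bigcupP; exists B.
by rewrite inE => yP eB; move: xB; rewrite eB inE => /eqP ->; rewrite ifN.
Qed.

Lemma mem_class_of x : x \in class_of x.
Proof. by rewrite -[class_of x]/(val (quo x)) -quo_eq. Qed.

Lemma quo_surj (B : identify P) : exists x, B = quo x.
Proof.
have [_ _ P0] := and3P partP.
suff /set0Pn[x xB] : val B != set0 by exists x; apply/esym/eqP; rewrite quo_eq.
case: B => B /= /setUP[BP|/imsetP[y _ ->]]; first by apply: contraNneq P0 => <-.
by apply/set0Pn; exists y; rewrite inE.
Qed.

Lemma quo_same x y : quo x = quo y ->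
  x = y \/ exists2 B, B \in P & (x \in B) && (y \in B).
Proof.
move/eqP; rewrite quo_eq /= /class_of; case: ifPn => yP xy.
  right; exists (pblock P y); first by rewrite pblock_mem.
  by rewrite xy mem_pblock.
by left; apply/eqP; rewrite -in_set1.
Qed.

Hypothesis stableD : {in D &, forall x y, ~~ sedge x y}.
Hypothesis uncommonP : forall (B : {set G}) (a b : G),
  B \in P -> a \in B -> b \in B -> a <> b -> ~ common_neighbor a b.

Lemma block_sub (B : {set G}) x : B \in P -> x \in B -> x \in D.
Proof.
by move=> BP xB; rewrite -(cover_partition partP); apply/bigcupP; exists B.
Qed.

(** Blocks lie inside the stable set [D], so no edge collapses to a loop. *)
Lemma quo_adj_neq x y : sedge x y -> quo x != quo y.
Proof.
move=> xy; apply/eqP => /quo_same[exy|[B BP /andP[xB yB]]].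
  by move: xy; rewrite exy sedge_irrefl.
by have := stableD (block_sub BP xB) (block_sub BP yB); rewrite xy.
Qed.

Lemma sedge_quo x y : sedge x y -> sedge (quo x) (quo y).
Proof.
move=> xy; rewrite /= /identify_rel quo_adj_neq //=.
apply/exists_inP; exists x; first exact: mem_class_of.
by apply/exists_inP; exists y; first exact: mem_class_of.
Qed.

Lemma sedge_identify (B C : identify P) :
  sedge B C -> exists x y, [/\ sedge x y, B = quo x & C = quo y].
Proof.
case/andP=> _ /exists_inP[x xB /exists_inP[y yC xy]]; exists x, y.
by split=> //; apply/esym/eqP; rewrite quo_eq.
Qed.

Lemma edges_identify :
  edges (identify P) = [set [set quo x | x in e] | e : {set G} in edges G].
Proof.
apply/setP=> E; apply/imsetP/imsetP.
  case=> -[B C]; rewrite inE /= => /sedge_identify[x [y [xy -> ->]]] ->.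
  exists [set x; y]; last by rewrite imsetU !imset_set1.
  by apply/imsetP; exists (x, y); rewrite ?inE.
case=> ? /imsetP[[x y]]; rewrite inE /= => xy -> ->.
exists (quo x, quo y); first by rewrite inE; apply: sedge_quo.
by rewrite imsetU !imset_set1.
Qed.

(* Two edges with the same image share the endpoint lying outside [D], so
   their other endpoints have a common neighbor. *)
Lemma quo_edge_inj a b c d :
  sedge a b -> sedge c d -> quo a = quo c -> quo b = quo d -> a = c /\ b = d.
Proof.
move=> ab cd /quo_same eq_ac /quo_same eq_bd; move: cd.
case: eq_ac => [<-|[B BP /andP[aB cB]]]; case: eq_bd => [<-|[C CP /andP[bC dC]]] cd.
- by [].
- split=> //; case: (eqVneq b d) => // /eqP bd.
  by case: (uncommonP CP bC dC bd); exists a; rewrite ![sedge _ a]sedge_sym.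
- split=> //; case: (eqVneq a c) => // /eqP ac.
  by case: (uncommonP BP aB cB ac); exists b.
- by have := stableD (block_sub BP aB) (block_sub CP bC); rewrite ab.
Qed.

Lemma quo_imset_inj : {in edges G &, injective (fun e : {set G} => quo @: e)}.
Proof.
move=> ? ? /imsetP[[a b] + ->] /imsetP[[c d] + ->].
rewrite !inE /= => ab cd; rewrite !imsetU !imset_set1 => /set2_inj[] [ac bd].
  by have [-> ->] := quo_edge_inj ab cd ac bd.
by rewrite sedge_sym in cd; have [-> ->] := quo_edge_inj ab cd ac bd; rewrite setUC.
Qed.

(** The two ends of an edge lie in different classes, so a class contains at most one of them. Read
    as numbers, these memberships make vertex sums additive over a class. *)
Lemma mem_quo_edge e (B : identify P) : e \in edges G ->
  (B \in quo @: e) = \sum_(x in val B) (x \in e) :> nat.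
Proof.
case/imsetP=> -[a b]; rewrite inE /= => ab ->.
have anb : a != b by apply: contraTneq ab => ->; rewrite sedge_irrefl.
have -> : (B \in quo @: [set a; b]) = (a \in val B) + (b \in val B) :> nat.
  rewrite imsetU !imset_set1 !inE eq_sym quo_eq [B == _]eq_sym quo_eq.
  case aB: (a \in _); case bB: (b \in _) => //.
  (* Only the case with both ends in [B] is left; it would give [quo a = quo b]. *)
  have := quo_adj_neq ab.
  by rewrite -quo_eq in aB; rewrite -quo_eq in bB; rewrite (eqP aB) (eqP bB) eqxx.
rewrite (eq_bigr (fun x => (x == a) + (x == b))).
  by rewrite big_split /= !sum_mem_eq.
move=> x _; rewrite !inE; by case: eqVneq => // ->; rewrite (negPf anb).
Qed.

(** Edges of [G] and of the quotient correspond bijectively, so one [lab] serves both. Double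
    counting the incidences between a class and the edges gives the new vertex sums. *)
Lemma labeling_identify (T : finType) (eps : T -> {set G}) (lab : T -> nat) :
  injective eps -> [set eps t | t : T] = edges G ->
  injective lab -> (forall t, 0 < lab t <= #|T|) ->
  exists2 f : {set identify P} -> nat, edge_labeling f &
    forall B, vsum f B = \sum_(x in val B) \sum_(t | x \in eps t) lab t.
Proof.
move=> eps_inj eps_img lab_inj lab_bd.
have epsE t : eps t \in edges G by rewrite -eps_img imset_f.
have [|| f f_lab f_sum] := @edge_labeling_transport (identify P) T
    (fun t => quo @: eps t) lab _ _ lab_inj lab_bd.
- by move=> t t' /quo_imset_inj eq_tt'; apply/eps_inj/eq_tt'.
- by rewrite edges_identify -eps_img -imset_comp.
exists f => // B; rewrite f_sum (eq_bigr _ (fun x _ => big_mkcond _ _)) exchange_big.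
rewrite big_mkcond /=; apply: eq_bigr => t _.
rewrite -mulnbl mem_quo_edge // big_distrl /=.
by apply: eq_bigr => x _; rewrite mulnbl.
Qed.

End Quotient.

(** * Evaluating and reindexing finite sums *)

Lemma sum_alternating (n a b : nat) :
  \sum_(j < 2 * n + 1) (if odd j then a else b) = n * a + n.+1 * b.
Proof.
elim: n => [|n IHn]; first by rewrite big_ord_recr big_ord0 /=; lia.
have -> : 2 * n.+1 + 1 = (2 * n + 1).+2 by lia.
by rewrite !big_ord_recr /= IHn oddD oddM /=; lia.
Qed.

Lemma sum_descending (c m : nat) : m <= c ->
  (\sum_(j < m) (c - j)) * 2 = m * (2 * c + 1 - m).
Proof.
elim: m => [|m IHm] le_mc; first by rewrite big_ord0.
have := IHm (ltnW le_mc); rewrite big_ord_recr /=; nia.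
Qed.

Lemma sum_ascending (m : nat) : (\sum_(j < m) j.+1) * 2 = m * m.+1.
Proof.
elim: m => [|m IHm]; first by rewrite big_ord0.
rewrite big_ord_recr /= mulnDl IHm; lia.
Qed.

Lemma big_pair_fst (I J : finType) (i0 : I) (F : I * J -> nat) :
  \sum_(p | p.1 == i0) F p = \sum_j F (i0, j).
Proof.
rewrite -(big_pred1_eq addn i0 (fun i => \sum_j F (i, j))) pair_big /=.
by apply: eq_big => [[i j]|[i j]] //=; rewrite andbT.
Qed.

Lemma big_pair_snd (I J : finType) (Q : pred I) (j0 : J) (F : I * J -> nat) :
  \sum_(p | Q p.1 && (p.2 == j0)) F p = \sum_(i | Q i) F (i, j0).
Proof.
rewrite (eq_bigr (fun i => \sum_(j | j == j0) F (i, j))).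
  by rewrite pair_big; apply: eq_big => [[i j]|[i j]].
by move=> i _; rewrite big_pred1_eq.
Qed.

(** * The labeling of [graphH] by rows and its vertex sums *)

Section LabelH.

Variables k n : nat.
Local Notation N := (2 * k).
Local Notation m := (2 * n + 1).

Lemma column_lt (i : 'I_N) : (if i < k then i : nat else rev_ord i) < k.
Proof. by case: (ltnP i k) => //= le_ki; have := ltn_ord i; lia. Qed.

(** Folds [i] and [rev_ord i] together: the index of the x-vertices adjacent to [u_i] and [v_i]. *)
Definition column (i : 'I_N) : 'I_k := Ordinal (column_lt i).

Lemma column_eq i (c : 'I_k) :
  (column i == c) = (i == c :> nat) || (rev_ord i == c :> nat).
Proof.
have := ltn_ord i; have := ltn_ord c; rewrite -val_eqE /=.
by case: (ltnP i k) => /=; lia.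
Qed.

Definition Hedge : finType := ('I_N + ('I_N * 'I_m + 'I_N * 'I_m))%type.

Definition Hends (t : Hedge) : {set graphH k n} :=
  match t with
  | inl i => [set Hu n i; Hv n i]
  | inr (inl (i, j)) => [set Hu n i; Hx (column i) j]
  | inr (inr (i, j)) => [set Hv n i; Hx (column i) j]
  end.

Lemma Hends_inj : injective Hends.
Proof.
by move=> [i|[[i j]|[i j]]] [i'|[[i' j']|[i' j']]] /set2_inj[] [] // [->] // [->].
Qed.

Lemma Hends_edges : [set Hends t | t : Hedge] = edges (graphH k n).
Proof.
have ArcP (a b : graphH k n) : Harc a b -> exists t, Hends t = [set a; b].
  case: a b => [[i|i]|[i j]] [[i'|i']|[c j']] //=.
  - by move=> /eqP <-; exists (inl i).
  - by rewrite -column_eq => /eqP <-; exists (inr (inl (i, j'))).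
  - by rewrite -column_eq => /eqP <-; exists (inr (inr (i, j'))).
apply/setP=> e; apply/imsetP/imsetP => [[t _ ->]|[[a b]]].
  have col_refl (i : 'I_N) : (i == column i :> nat) || (rev_ord i == column i :> nat).
    by rewrite -column_eq.
  case: t => [i|[[i j]|[i j]]].
  - by exists (Hu n i, Hv n i); rewrite // inE /= /Hrel /= eqxx.
  - by exists (Hu n i, Hx (column i) j); rewrite // inE /= /Hrel /= col_refl.
  - by exists (Hv n i, Hx (column i) j); rewrite // inE /= /Hrel /= col_refl.
rewrite inE /= => /orP[] /ArcP[t te] ->; exists t => //.
by rewrite setUC te.
Qed.

Definition cell (t : nat) (d : bool) (i : 'I_N) : nat :=
  (t * N + (if d then i else rev_ord i)).+1.

(* The row indices of [u_i x_ij] and [v_i x_ij] add up to [2 * m + 1] for every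
   [j], which is what makes the sum at [x_ij] independent of [j]. *)
Definition Hlabel (t : Hedge) : nat :=
  match t with
  | inl i => cell 0 true i
  | inr (inl (i, j)) => cell (2 * m - j) (odd j) i
  | inr (inr (i, j)) => cell j.+1 (odd j) i
  end.

(** Division by [N] recovers the row. The position is recovered only for equal reading directions,
    which suffices because [Hlabel] reads each row in a single direction. *)
Lemma cell_inj t t' d d' i i' :
  cell t d i = cell t' d' i' -> t = t' /\ (d = d' -> i = i').
Proof.
have N_gt0 : 0 < N by have := ltn_ord i; lia.
move=> [eq_c]; have eq_t : t = t'.
  by have := congr1 (divn^~ N) eq_c; rewrite !divnMDl // !divn_small ?addn0 ?ltn_ord.
split=> // eq_d; move: eq_c; rewrite eq_t eq_d => /addnI; move/val_inj.
by case: d' {eq_d} => // /rev_ord_inj.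
Qed.

(** The three kinds of edges use disjoint sets of rows: 0, then 1 to [m], then [m + 1] to
    [2 * m]. *)
Lemma Hlabel_inj : injective Hlabel.
Proof.
move=> [i|[[i j]|[i j]]] [i'|[[i' j']|[i' j']]] /= /cell_inj[] eq_row eq_i;
  try (have lt_j := ltn_ord j); try (have lt_j' := ltn_ord j'); try lia.
- by rewrite eq_i.
- have eq_j : j = j' by apply: val_inj => /=; lia.
  by rewrite eq_i eq_j.
- have eq_j : j = j' by apply: val_inj => /=; lia.
  by rewrite eq_i eq_j.
Qed.

Lemma Hlabel_bounds t : 0 < Hlabel t <= #|Hedge|.
Proof.
have cell_le r d i : r <= 2 * m -> cell r d i <= #|Hedge|.
  rewrite !card_sum !card_prod !card_ord /cell => le_r.
  have : r * N <= 2 * m * N by rewrite leq_mul2r le_r orbT.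
  by have := ltn_ord (if d then i else rev_ord i); lia.
case: t => [i|[[i j]|[i j]]] /=; rewrite cell_le //; have := ltn_ord j; lia.
Qed.


Definition Hsum (x : graphH k n) : nat := \sum_(t | x \in Hends t) Hlabel t.

(** Row 0 and the [n] odd [j] are read forwards, the [n.+1] even [j] backwards. Each of the [n.+1]
    pairs contributes [i + rev_ord i + 2 = N.+1] besides the row offsets. *)
Lemma sum_cells (r : nat -> nat) (i : 'I_N) :
  cell 0 true i + \sum_(j < m) cell (r j) (odd j) i =
  n.+1 * N.+1 + (\sum_(j < m) r j) * N.
Proof.
have cellE t d : cell t d i = t * N + 1 + (if d then i : nat else rev_ord i).
  by rewrite /cell; case: d => /=; lia.
rewrite (eq_bigr _ (fun j _ => cellE _ _)) !big_split /= sum_alternating.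
rewrite -big_distrl sum1_card card_ord cellE /=.
(* With [N = i.+1 + b], the value of [rev_ord i] is [b] and no truncated subtraction remains. *)
have := subnKC (ltn_ord i); move: (N - i.+1) => b.
by move: (nat_of_ord i) => a <-; lia.
Qed.

Lemma Hsum_u (i : 'I_N) :
  Hsum (Hu n i) = n.+1 * N.+1 + (2 * n + 1) * (3 * n + 2) * N.
Proof.
have mem_u t : (Hu n i \in Hends t) =
    match t with inl i' => i' == i | inr (inl p) => p.1 == i | _ => false end.
  by case: t => [i'|[[i' j]|[i' j]]]; rewrite !inE /= ?orbF eq_sym.
rewrite /Hsum (eq_bigl _ _ mem_u) !big_sumType /= big_pred1_eq big_pair_fst /=.
rewrite big_pred0_eq addn0 (sum_cells (fun j => 2 * m - j)).
(* The row indices add up to [m * (3 * m + 1) / 2 = (2 * n + 1) * (3 * n + 2)]. *)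
by have := @sum_descending (2 * m) m; nia.
Qed.

Lemma Hsum_v (i : 'I_N) :
  Hsum (Hv n i) = n.+1 * N.+1 + (2 * n + 1) * n.+1 * N.
Proof.
have mem_v t : (Hv n i \in Hends t) =
    match t with inl i' => i' == i | inr (inr p) => p.1 == i | _ => false end.
  by case: t => [i'|[[i' j]|[i' j]]]; rewrite !inE /= ?orbF eq_sym.
rewrite /Hsum (eq_bigl _ _ mem_v) !big_sumType /= big_pred1_eq big_pair_fst /=.
rewrite big_pred0_eq add0n (sum_cells S).
by have := sum_ascending m; nia.
Qed.

Lemma big_column (c : 'I_k) (F : 'I_N -> nat) : exists i : 'I_N,
  \sum_(i' | column i' == c) F i' = F i + F (rev_ord i).
Proof.
have lt_cN : c < N by have := ltn_ord c; lia.
exists (Ordinal lt_cN).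
(* As [c < k], its mirror image [2 * k - 1 - c] is at least [k], so the fiber of [column] has
   exactly two elements. *)
have neq : rev_ord (Ordinal lt_cN) != Ordinal lt_cN.
  by rewrite -val_eqE /=; lia.
rewrite (bigD1 (Ordinal lt_cN)) ?column_eq ?eqxx //=; congr addn.
rewrite (big_pred1 (rev_ord (Ordinal lt_cN))) // => i.
rewrite /= column_eq -!val_eqE /=.
by have := ltn_ord i; have := ltn_ord c; lia.
Qed.

Lemma Hsum_x (c : 'I_k) (j : 'I_m) : Hsum (Hx c j) = 8 * n.+1 * N + 2.
Proof.
have mem_x t : (Hx c j \in Hends t) =
    match t with inl _ => false
    | inr (inl p) | inr (inr p) => (column p.1 == c) && (p.2 == j) end.
  by case: t => [i|[[i j']|[i j']]]; rewrite !inE //= eq_sym.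
rewrite /Hsum (eq_bigl _ _ mem_x) !big_sumType /= big_pred0_eq add0n.
rewrite !(big_pair_snd (fun i => column i == c)) -big_split /=.
have [i ->] := big_column c (fun i => cell (2 * m - j) (odd j) i + cell j.+1 (odd j) i).
have pairE t d : cell t d i + cell t d (rev_ord i) = 2 * t * N + N.+1.
  by rewrite /cell; have := ltn_ord i; case: d => /=; lia.
have := pairE (2 * m - j) (odd j); have := pairE j.+1 (odd j).
(* This form shows that the two row indices add up to [2 * m + 1]; the sum is then
   [2 * (2 * m + 1) * N + 2 * N.+1]. *)
have -> : 2 * m - j = 2 * m + 1 - j.+1 by lia.
have := ltn_ord j; nia.
Qed.

End LabelH.

(** * Distinctness of the three colors and the conclusion *)

Lemma color_values_neq (N s n : nat) : 2 < N -> 1 < s -> 0 < n ->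
  let cu := s * (n.+1 * N.+1 + (2 * n + 1) * (3 * n + 2) * N) in
  let cv := n.+1 * N.+1 + (2 * n + 1) * n.+1 * N in
  let cx := 8 * n.+1 * N + 2 in
  [/\ cu != cv, cu != cx & cv != cx].
Proof.
move=> N_gt2 s_gt1 n_gt0 cu cv cx.
have cu_ge : 2 * (n.+1 * N.+1 + (2 * n + 1) * (3 * n + 2) * N) <= cu.
  by rewrite leq_mul2r s_gt1 orbT.
split; apply/eqP.
- by move: cu_ge; rewrite /cv; nia.
- by move: cu_ge; rewrite /cx; nia.
(* Here [cv = 2 * (n + 1)^2 * N + (n + 1)], which is below [cx] for [n] equal to 1 or 2 and above it
   from 3 on. At [n = 3] the coefficients of [N] agree and only the constants 4 and 2 differ. *)
- rewrite /cv /cx {cu cv cx cu_ge}; case: n n_gt0 => [|[|[|n]]] // _; nia.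
Qed.

(** [graphH] is tripartite with parts the u's, the v's and the x's, so a color depending only on the
    part is proper once its three values differ. *)
Lemma sedge_kinds k n (T : eqType) (p q r : T) (x y : graphH k n) :
  p != q -> p != r -> q != r -> sedge x y ->
  let kind (z : graphH k n) :=
    match z with inl (inl _) => p | inl (inr _) => q | inr _ => r end in
  kind x != kind y.
Proof.
by move=> pq pr qr; case: x y => [[?|?]|[? ?]] [[?|?]|[? ?]] //= _; rewrite // eq_sym.
Qed.

Theorem theorem3p9 (k s n : nat) (hk : 2 <= k) (hs : 2 <= s) (hn : 1 <= n)
  (P : {set {set graphH k n}})
  (partP : partition P (Hus k n))
  (sizeP : forall B : {set graphH k n}, B \in P -> #|B| = s)
  (nocommonP : forall (B : {set graphH k n}) (a b : graphH k n),
     B \in P -> a \in B -> b \in B -> a <> b -> ~ common_neighbor a b) :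
  is_chi_la (identify P) 3.
Proof.
have stableHus : {in Hus k n &, forall x y, ~~ sedge x y}.
  by move=> _ _ /imsetP[i _ ->] /imsetP[j _ ->].
have [i0_lt c0_lt j0_lt] : [/\ 0 < 2 * k, 0 < k & 0 < 2 * n + 1] by split; lia.
pose u0 := Hu n (Ordinal i0_lt).
pose v0 := Hv n (Ordinal i0_lt).
pose x0 := Hx (Ordinal c0_lt) (Ordinal j0_lt).
have triangle (f : {set identify P} -> nat) : local_antimagic f -> 3 <= num_colors f.
  move=> anti; have adj := sedge_quo partP stableHus.
  exact: (three_colors anti (adj u0 v0 isT) (adj v0 x0 isT) (adj u0 x0 isT)).
split=> //.
have [f f_lab f_sum] := labeling_identify partP stableHus nocommonP
  (@Hends_inj k n) (Hends_edges k n) (@Hlabel_inj k n) (@Hlabel_bounds k n).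
pose cu := s * (n.+1 * (2 * k).+1 + (2 * n + 1) * (3 * n + 2) * (2 * k)).
pose cv := n.+1 * (2 * k).+1 + (2 * n + 1) * n.+1 * (2 * k).
pose cx := 8 * n.+1 * (2 * k) + 2.
pose color (z : graphH k n) :=
  match z with inl (inl _) => cu | inl (inr _) => cv | inr _ => cx end.
have vsumE z : vsum f (quo P z) = color z.
  rewrite f_sum /= /class_of (cover_partition partP).
  case: z => [[i|i]|[c j]].
  - have iHus : Hu n i \in Hus k n by apply: imset_f.
    have blockP : pblock P (Hu n i) \in P.
      by apply: pblock_mem; rewrite (cover_partition partP).
    (* A block has [s] elements, all u's with the same sum in [graphH], whence the factor [s] in
       [cu]. *)
    rewrite iHus /= /cu -(sizeP _ blockP) -sum_nat_const; apply: eq_bigr => x.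
    by move=> /(block_sub partP blockP) /imsetP[i' _ ->]; apply: Hsum_u.
  (* Vertices outside the u's form singleton classes and keep their sums. *)
  - rewrite ifN; last by apply/imsetP => -[].
    by rewrite big_set1 -[LHS]/(Hsum (Hv n i)) Hsum_v.
  - rewrite ifN; last by apply/imsetP => -[].
    by rewrite big_set1 -[LHS]/(Hsum (Hx c j)) Hsum_x.
have [cu_cv cu_cx cv_cx] : [/\ cu != cv, cu != cx & cv != cx].
  by apply: color_values_neq => //; lia.
have anti : local_antimagic f.
  split=> // B C /(sedge_identify partP)[x [y [xy -> ->]]].
  by rewrite !vsumE; apply/eqP/sedge_kinds.
exists f => //; apply/eqP; rewrite eqn_leq triangle // andbT.
rewrite -[3]/(size [:: cu; cv; cx]).
apply: uniq_leq_size => [|y]; first exact: undup_uniq.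
rewrite mem_undup => /mapP[B _ ->]; have [z ->] := quo_surj partP B.
by rewrite vsumE !inE; case: z => [[i|i]|[c j]] /=; rewrite eqxx ?orbT.
Qed.
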